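(* Let $G_2$ be a finite group which acts trivially on an abelian torsion group $G_1$, and let $\varepsilon_1,\varepsilon_2\in Z^2(G_2,G_1)$. Let $\pi(G_2)=\{p_1,\dots,p_k\}$ be the set of prime divisors of $|G_2|$ and, for each $1\le i\le k$, let $G_{2i}$ be a Sylow $p_i$-subgroup of $G_2$, let $G_{1p_i}$ be the $p_i$-component of $G_1$, and let $\varepsilon_{1i},\varepsilon_{2i}\in Z^2(G_{2i},G_{1p_i})$ be the cocycles induced by $\varepsilon_1,\varepsilon_2$ respectively. Let $H=\mathrm{Im}(\varepsilon_1)$ and $H_i=\mathrm{Im}(\varepsilon_{1i})$ for all $1\le i\le k$. Then $G_1\underset{\varepsilon_1}{\times}G_2$ and $G_1\underset{\varepsilon_2}{\times}G_2$ are $(H,G_2)$-isomorphic if and only if $G_{1p_i}\underset{\varepsilon_{1i}}{\times}G_{2i}$ and $G_{1p_i}\underset{\varepsilon_{2i}}{\times}G_{2i}$ are $(H_i,G_{2i})$-isomorphic for all $1\le i\le k$.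
   Context: Groups are written multiplicatively. For a group $Q$ acting trivially on an abelian group $A$, $Z^2(Q,A)$ is the group of normalized 2-cocycles, i.e. maps $\varepsilon:Q\times Q\to A$ with $\varepsilon(g,1)=\varepsilon(1,g)=1$ and $\varepsilon(h,g)\varepsilon(hg,k)=\varepsilon(g,k)\varepsilon(h,gk)$ for all $g,h,k\in Q$. The perturbed direct product $A\underset{\varepsilon}{\times}Q$ is the group with underlying set $A\times Q$ and operation $(x,y)(x',y')=(xx'\varepsilon(y,y'),yy')$. For a homomorphism $\varphi:A\underset{\varepsilon}{\times}Q\to A\underset{\varepsilon'}{\times}Q$, write $\varphi_{11}(x)$ and $\varphi_{21}(x)$ for the $A$- and $Q$-coordinates of $\varphi(x,1)$ ($x\in A$), and $\varphi_{12}(y)$ and $\varphi_{22}(y)$ for the $A$- and $Q$-coordinates of $\varphi(1,y)$ ($y\in Q$). For a subset $H\subseteq A$, the groups $A\underset{\varepsilon}{\times}Q$ and $A\underset{\varepsilon'}{\times}Q$ are called $(H,Q)$-isomorphic if there is a group isomorphism $\varphi$ from the first to the second with $\varphi_{22}=id_Q$ and $\varphi_{11}(h)=h$ for all $h\in H$. An abelian torsion group $G_1$ is the restricted direct product of its $p$-components $G_{1p}$ (the subgroup of elements of $p$-power order). For $j\in\{1,2\}$, $\varepsilon_{ji}$ denotes the restriction of $\varepsilon_j$ to $G_{2i}\times G_{2i}$ followed by the projection $G_1\to G_{1p_i}$. $\mathrm{Im}$ denotes the image of a map (a set). *)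

(* Defs.v *)
From HB Require Import structures.
From mathcomp Require Import all_boot all_fingroup all_algebra all_solvable.
From mathcomp Require Import boolp classical_sets.

Set Implicit Arguments.
Unset Strict Implicit.
Unset Printing Implicit Defensive.

Import GRing.Theory.
Local Open Scope ring_scope.

(* The abelian group A is a zmodType, hence written additively, while Q is a  *)
(* multiplicative group acting trivially on A.                                *)

Record cocycle2 (Q : groupType) (A : zmodType) := Cocycle2 {
  cocycle2_fun :> Q -> Q -> A;
  cocycle2g1 : forall g, cocycle2_fun g 1%g = 0;
  cocycle21g : forall g, cocycle2_fun 1%g g = 0;
  cocycle2A : forall h g k,
    cocycle2_fun h g + cocycle2_fun (h * g)%g k
    = cocycle2_fun g k + cocycle2_fun h (g * k)%g
}.

Definition cocycle_im (Q : groupType) (A : zmodType) (e : cocycle2 Q A) :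
  set A := range (fun yz : Q * Q => e yz.1 yz.2).

Definition perturbed_prod (Q : groupType) (A : zmodType) (e : cocycle2 Q A) :
  Type := (A * Q)%type.

Section PerturbedProduct.
Variables (Q : groupType) (A : zmodType) (e : cocycle2 Q A).

HB.instance Definition _ := Choice.on (perturbed_prod e).

Definition pert_mul (u v : perturbed_prod e) : perturbed_prod e :=
  (u.1 + v.1 + e u.2 v.2, (u.2 * v.2)%g).

Definition pert_one : perturbed_prod e := (0, 1%g).

Definition pert_inv (u : perturbed_prod e) : perturbed_prod e :=
  (- u.1 - e u.2 (u.2)^-1%g, (u.2)^-1%g).

Fact pert_mulA : associative pert_mul.
Proof.
move=> [x g] [y h] [z k]; rewrite /pert_mul /= mulgA; congr pair.
have E := cocycle2A e g h k.
rewrite [RHS]addrAC -(addrA _ (e g h)) E.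
by rewrite !addrA addrAC [in RHS]addrAC -!addrA.
Qed.

Fact pert_mul1 : left_id pert_one pert_mul.
Proof. by move=> [x g]; rewrite /pert_mul /= cocycle21g mul1g add0r addr0. Qed.

Fact pert_mulg1 : right_id pert_one pert_mul.
Proof. by move=> [x g]; rewrite /pert_mul /= cocycle2g1 mulg1 !addr0. Qed.

Fact pert_mulV : left_inverse pert_one pert_inv pert_mul.
Proof.
move=> [x g]; rewrite /pert_mul /= mulVg; congr pair.
have := cocycle2A e g g^-1%g g.
rewrite mulgV mulVg cocycle21g cocycle2g1 !addr0 => ->.
by rewrite addrAC subrK addNr.
Qed.

Fact pert_mulgV : right_inverse pert_one pert_inv pert_mul.
Proof. by move=> [x g]; rewrite /pert_mul /= mulgV addrA subrr sub0r addNr. Qed.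

HB.instance Definition _ := isGroup.Build (perturbed_prod e)
  pert_mulA pert_mul1 pert_mulg1 pert_mulV pert_mulgV.

End PerturbedProduct.

Section HQIsomorphism.
Variables (Q : groupType) (A : zmodType).

Definition phi11 (e e' : cocycle2 Q A)
  (phi : perturbed_prod e -> perturbed_prod e') (x : A) : A := (phi (x, 1%g)).1.

Definition phi22 (e e' : cocycle2 Q A)
  (phi : perturbed_prod e -> perturbed_prod e') (y : Q) : Q := (phi (0, y)).2.

Definition HQ_isomorphic (H : set A) (e e' : cocycle2 Q A) : Prop :=
  exists phi : {multiplicative perturbed_prod e -> perturbed_prod e'},
    [/\ bijective phi,
        forall y, phi22 phi y = y
      & forall h, H h -> phi11 phi h = h].

End HQIsomorphism.

Definition torsion_group (A : zmodType) : Prop :=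
  forall x : A, exists2 n, (0 < n)%N & x *+ n = 0.

Section PComponent.
Variables (A : zmodType) (p : nat).

Definition in_pcomponent : {pred A} :=
  fun x => `[< exists n, x *+ (p ^ n)%N = 0 >].

Fact in_pcomponent_zmod_closed : zmod_closed in_pcomponent.
Proof.
split; first by apply/asboolP; exists 0; rewrite mul0rn.
move=> x y /asboolP[m xm] /asboolP[n yn]; apply/asboolP; exists (m + n)%N.
by rewrite mulrnBl expnD mulrnA xm mul0rn mulnC mulrnA yn mul0rn subr0.
Qed.
HB.instance Definition _ :=
  GRing.isZmodClosed.Build A in_pcomponent in_pcomponent_zmod_closed.

Record pcomponent := PComponent {
  pcomponent_val : A;
  _ : pcomponent_val \in in_pcomponent
}.

HB.instance Definition _ := [isSub for pcomponent_val].
HB.instance Definition _ := [Choice of pcomponent by <:].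
HB.instance Definition _ := [SubChoice_isSubZmodule of pcomponent by <:].

End PComponent.

Section Projection.
Variable A : zmodType.

(* c is the family of coordinates of x in the restricted direct product of    *)
(* the p-components; coordinates at non-prime indices are 0 by convention.    *)
Definition pdecomposition (x : A) (c : forall p, pcomponent A p) : Prop :=
  (forall p, ~~ prime p -> c p = 0) /\
  exists2 N : nat, (forall p, (N <= p)%N -> c p = 0)
                 & x = \sum_(p < N) val (c p).

(* The p-th coordinate of x, with default value 0 if x has no decomposition,  *)
(* which cannot happen in a torsion group.                                    *)
Definition pproj (p : nat) (x : A) : pcomponent A p :=
  xget 0 [set y | exists2 c, pdecomposition x c & y = c p].

Lemma pdecomposition_widen x (c : forall p, pcomponent A p) N M :
    (forall p, (N <= p)%N -> c p = 0) ->
    (N <= M)%N -> x = \sum_(p < N) val (c p) ->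
  x = \sum_(p < M) val (c p).
Proof.
move=> c0 /subnKC <- ->; rewrite big_split_ord /= [X in _ + X]big1 ?addr0 //.
by move=> i _; rewrite c0 ?leq_addr ?raddf0.
Qed.

Lemma pdecompositionB x y c d : pdecomposition x c -> pdecomposition y d ->
  pdecomposition (x - y) (fun p => c p - d p).
Proof.
move=> [pc [N c0 xE]] [pd [M d0 yE]]; split=> [p pP|].
  by rewrite pc ?pd ?subr0.
exists (maxn N M) => [p|].
  by rewrite geq_max => /andP[Np Mp]; rewrite c0 ?d0 ?subr0.
rewrite (pdecomposition_widen c0 (leq_maxl N M) xE).
rewrite (pdecomposition_widen d0 (leq_maxr N M) yE).
by rewrite -sumrB; apply: eq_bigr => i _; rewrite raddfB.
Qed.

Lemma pdecomposition0 : pdecomposition 0 (fun p => 0).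
Proof. by split=> //; exists 0%N => //; rewrite big_ord0. Qed.

Lemma pdecompositionD x y c d : pdecomposition x c -> pdecomposition y d ->
  pdecomposition (x + y) (fun p => c p + d p).
Proof.
move=> xc yd.
have := pdecompositionB xc (pdecompositionB pdecomposition0 yd).
rewrite sub0r opprK; congr pdecomposition.
by apply: functional_extensionality_dep => p; rewrite sub0r opprK.
Qed.

Lemma pdecomposition_eq0 c : pdecomposition 0 c -> forall p, c p = 0.
Proof.
move=> [pc [N c0 sum0]] p.
have [pP|/pc//] := boolP (prime p).
have [/c0//|pN] := leqP N p.
suff [m pm cm] : exists2 m, coprime p m &
    (\sum_(q < N | q != Ordinal pN) val (c q)) *+ m = 0.
  move: sum0; rewrite (bigD1 (Ordinal pN)) //= => /esym/eqP.
  rewrite addr_eq0 => /eqP cE; apply/val_inj; rewrite raddf0.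
  have {cE cm} cm : val (c p) *+ m = 0 by rewrite [val _]cE mulNrn cm oppr0.
  have /asboolP[n cn] := valP (c p).
  have pm' : coprime (p ^ n) m by rewrite coprimeXl.
  have m0 : (0 < p ^ n)%N by rewrite expn_gt0 prime_gt0.
  have [[u v] /= /andP[uv _]]: exists w : nat * nat,
      (w.1 * p ^ n == w.2 * m + 1)%N && true.
    have [u v E _] := egcdnP m m0.
    by exists (u, v); rewrite /= E (eqP pm') eqxx.
  have := mulr1n (val (c p)).
  have -> : val (c p) *+ 1 = val (c p) *+ (v * m + 1).
    by rewrite mulrnDr mulnC mulrnA cm mul0rn add0r.
  by rewrite -(eqP uv) mulnC mulrnA cn mul0rn => <-.
elim/big_rec: _ => [|q x qp [m pm xm]]; first by exists 1%N; rewrite ?coprimen1.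
have [qP|/pc->] := boolP (prime q); last by exists m; rewrite ?add0r.
have /asboolP[n cn] := valP (c q).
exists (q ^ n * m)%N.
  rewrite coprimeMr pm andbT coprimeXr // prime_coprime // dvdn_prime2 //.
  by apply: contra qp => /eqP pq; apply/eqP/val_inj.
by rewrite mulrnDl mulrnA cn mul0rn mulnC mulrnA xm mul0rn addr0.
Qed.

Lemma pdecomposition_uniq x c d : pdecomposition x c -> pdecomposition x d ->
  forall p, c p = d p.
Proof.
move=> xc xd p; have := pdecompositionB xc xd; rewrite subrr.
by move=> /pdecomposition_eq0/(_ p)/eqP; rewrite subr_eq0 => /eqP.
Qed.

Lemma pdecomposition_pelt p x : prime p -> x \in @in_pcomponent A p ->
  exists c, pdecomposition x c.
Proof.
move=> pP xp.
pose c q : pcomponent A q := insubd 0 (if q == p then x else 0).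
have c0 q : q != p -> c q = 0.
  move=> /negPf qp; apply/val_inj.
  by rewrite /c qp val_insubd rpred0 raddf0.
exists c; split=> [q qP|].
  by apply: c0; apply: contraNneq qP => ->.
exists p.+1 => [q pq|]; first by apply: c0; rewrite gtn_eqF.
rewrite big_ord_recr /= big1 => [|i _]; last first.
  by rewrite c0 ?raddf0 // ltn_eqF.
by rewrite add0r val_insubd eqxx xp.
Qed.

Lemma pdecomposition_exists : torsion_group A ->
  forall x, exists c, pdecomposition x c.
Proof.
move=> tA x; have [n] := tA x.
have [k] := ubnP n; elim: k n x => // k IHk n x /ltnSE nk n0 xn.
have [n1|n1] := leqP n 1.
  exists (fun p => 0); suff -> : x = 0 by exact: pdecomposition0.
  by move: xn; have -> : n = 1%N by apply/eqP; rewrite eqn_leq n1 n0.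
set p := pdiv n; have pP : prime p by exact: pdiv_prime.
have [m pm nE] := pfactor_coprime pP n0.
set a := logn p n in nE.
have a0 : (0 < a)%N by rewrite logn_gt0 mem_primes pP n0 pdiv_dvd.
have m0 : (0 < m)%N by move: n0; rewrite nE muln_gt0 => /andP[].
have pam : coprime (p ^ a) m by rewrite coprimeXl.
have pa0 : (0 < p ^ a)%N by rewrite expn_gt0 prime_gt0.
have [u v E _] := egcdnP m pa0.
rewrite (eqP pam) in E.
have [c xc] : exists c, pdecomposition (x *+ (u * p ^ a)) c.
  apply: (IHk m) => //; last first.
    by rewrite -mulrnA -mulnA [(_ * m)%N]mulnC -nE mulnC mulrnA xn mul0rn.
  apply: leq_trans nk; rewrite nE ltn_Pmulr //.
  by apply: leq_trans (prime_gt1 pP) _; rewrite -{1}(expn1 p) leq_exp2l ?prime_gt1.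
have [d xd] : exists d, pdecomposition (x *+ (v * m)) d.
  apply: (pdecomposition_pelt pP); apply/asboolP; exists a.
  by rewrite -mulrnA -mulnA -nE mulnC mulrnA xn mul0rn.
exists (fun p => c p - d p).
suff -> : x = x *+ (u * p ^ a) - x *+ (v * m) by exact: pdecompositionB.
by rewrite E mulrnDr addrAC subrr add0r.
Qed.

Lemma pproj_decomposition x c p : pdecomposition x c -> pproj p x = c p.
Proof.
move=> xc; rewrite /pproj; case: xgetP => [y _ [d xd ->]|/(_ (c p))[]].
  exact: pdecomposition_uniq xd xc p.
by exists c.
Qed.

Lemma pprojD : torsion_group A -> forall p, {morph @pproj p : x y / x + y}.
Proof.
move=> tA p x y.
have [c xc] := pdecomposition_exists tA x.
have [d yd] := pdecomposition_exists tA y.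
rewrite (pproj_decomposition p xc) (pproj_decomposition p yd).
by rewrite (pproj_decomposition p (pdecompositionD xc yd)).
Qed.

Lemma pproj0 p : pproj p 0 = 0.
Proof. exact: (pproj_decomposition p pdecomposition0). Qed.

End Projection.

Section InducedCocycle.
Variables (A : zmodType) (Q : finGroupType) (torA : torsion_group A).
Variables (e : cocycle2 Q A) (p : nat) (P : {group Q}).

Let ind (g h : subg_of P) : pcomponent A p := pproj p (e (sgval g) (sgval h)).

Fact ind_g1 g : ind g 1%g = 0.
Proof. by rewrite /ind cocycle2g1 pproj0. Qed.

Fact ind_1g g : ind 1%g g = 0.
Proof. by rewrite /ind cocycle21g pproj0. Qed.

Fact ind_A h g k : ind h g + ind (h * g)%g k = ind g k + ind h (g * k)%g.
Proof. by rewrite /ind -!(pprojD torA) cocycle2A. Qed.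

Definition induced_cocycle : cocycle2 (subg_of P) (pcomponent A p) :=
  Cocycle2 ind_g1 ind_1g ind_A.

End InducedCocycle.

(* Main.v *)
Require Import Defs.
From HB Require Import structures.
From mathcomp Require Import all_boot all_fingroup all_algebra all_solvable.
From mathcomp Require Import boolp.

Set Implicit Arguments.
Unset Strict Implicit.
Unset Printing Implicit Defensive.

Import GRing.Theory.
Local Open Scope ring_scope.

(** The proof is cohomological.  An isomorphism that is the identity on [Q] and
    on the values of [e] amounts to a solution [t] of
    [e g h - e' g h = t g + t h - t (g * h)]
    ([HQ_isomorphic_coboundary]), so that the theorem says that a class in
    [H^2(Q, A)], here that of [e1 - e2], vanishes if and only if the
    [p]-component of its restriction to a Sylow [p]-subgroup vanishes for each
    prime [p] dividing the order of [Q].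

    Projecting and restricting a cochain [t] gives one direction.  For the
    other, consider the integers [n] such that [n * (e1 - e2)] is a coboundary.
    They are closed under gcd, so it suffices to find a positive one and, for
    each of its prime divisors [p], another one that is prime to [p]
    ([coboundary_coprime_multiples]).  Both come from transfer: a cocycle that
    becomes trivial on a subgroup is killed by the index of that subgroup
    ([coboundary_index]).  Applied to the trivial subgroup, this gives [#|Q|].
    For [p] dividing [#|Q|], the cocycle takes finitely many values in a torsion
    group, so some [m] prime to [p] kills their prime-to-[p] parts
    ([pproj_common_multiple]); the hypothesis at [p] then says that
    [m * (e1 - e2)] is trivial on the Sylow [p]-subgroup, whose index is prime
    to [p], and the product of [m] with that index is the required integer. *)

(** * Isomorphisms of perturbed products and coboundaries *)

Definition coboundary (Q : groupType) (A : zmodType) (f : Q -> Q -> A) : Prop :=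
  exists t : Q -> A, forall g h, f g h = t g + t h - t (g * h)%g.

Section IsomorphismAndCohomology.
Variables (Q : groupType) (A : zmodType).
Implicit Types e : cocycle2 Q A.

(** Applying an isomorphism [phi] to [(0, g) * (0, h) = (e g h, 1) * (0, g * h)]
    and comparing [Q]-coordinates shows that [phi] maps [(e g h, 1)] into [A],
    hence to itself; the [A]-coordinates then say that [y |-> (phi (0, y)).1]
    has coboundary [e - e'].  Conversely, [(x, y) |-> (x + t y, y)] is the
    identity on all of [A]. *)
Lemma HQ_isomorphic_coboundary e e' :
  HQ_isomorphic (cocycle_im e) e e' <-> coboundary (fun g h => e g h - e' g h).
Proof.
split=> [[phi [_ phi22E phi11E]] | [t tE]].
  exists (fun y => (phi (0, y)).1) => g h /=.
  have lift y : phi (0, y) = ((phi (0, y)).1, y).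
    by rewrite [LHS]surjective_pairing; congr pair; exact: phi22E.
  (* Until the two products are compared, the second coordinate of
     [phi (e g h, 1)] is an unknown element of [Q]. *)
  have image : phi (e g h, 1%g) = (e g h, (phi (e g h, 1%g)).2).
    rewrite [LHS]surjective_pairing; congr pair.
    by apply: phi11E; exists (g, h).
  pose a := (0, g) : perturbed_prod e; pose b := (0, h) : perturbed_prod e.
  pose z := (e g h, 1%g) : perturbed_prod e.
  pose ab := (0, (g * h)%g) : perturbed_prod e.
  have abE : (a * b)%g = (z * ab)%g.
    rewrite /mulg /= /pert_mul /a /b /z /ab /=.
    by rewrite !addr0 add0r cocycle21g addr0 mul1g.
  have := congr1 phi abE; rewrite !gmulfM.
  rewrite /a /b /z /ab image (lift g) (lift h) (lift (g * h)%g).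
  rewrite /mulg /= /pert_mul /= => -[xE yE].
  have k1 : (phi (e g h, 1%g)).2 = 1%g.
    by apply: (mulIg (g * h)%g); rewrite mul1g -yE.
  rewrite k1 cocycle21g addr0 in xE.
  by apply/eqP; rewrite subr_eq addrAC xE addrK.
pose phi (u : perturbed_prod e) : perturbed_prod e' := (u.1 + t u.2, u.2).
pose psi (u : perturbed_prod e') : perturbed_prod e := (u.1 - t u.2, u.2).
have phiM : {morph phi : u v / (u * v)%g}.
  move=> [x g] [y h]; rewrite /mulg /= /pert_mul /phi /=; congr pair.
  rewrite [x + t g + _]addrACA -!addrA; congr (_ + (_ + _)).
  by rewrite -[e g h](subrK (e' g h)) tE addrAC subrK addrA.
pose phiX : {multiplicative perturbed_prod e -> perturbed_prod e'} :=
  HB.pack phi (isMultiplicative.Build _ _ phi phiM).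
exists phiX; split=> [|//|x _].
  by exists psi => -[x y]; rewrite /= /psi /phi /= ?addrK ?subrK.
(* [t] maps 1 to 0 because both cocycles are normalized. *)
have t1 : t 1%g = 0.
  by have := tE 1%g 1%g; rewrite !cocycle21g subrr mulg1 addrK => <-.
by rewrite /phi11 /= t1 addr0.
Qed.

End IsomorphismAndCohomology.

(** * Multiples of a cochain that are coboundaries *)

Section Multiples.
Variables (Q : groupType) (A : zmodType).
Implicit Type f : Q -> Q -> A.

Lemma coboundaryMn f n : coboundary f -> coboundary (fun g h => f g h *+ n).
Proof.
case=> t tE; exists (fun g => t g *+ n) => g h.
by rewrite tE mulrnBl mulrnDl.
Qed.

Lemma coboundaryB f f' : coboundary f -> coboundary f' ->
  coboundary (fun g h => f g h - f' g h).
Proof.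
move=> [t tE] [t' t'E]; exists (fun g => t g - t' g) => g h.
rewrite tE t'E [t g - _ + _]addrACA -opprD !opprB addrACA [RHS]addrACA.
by rewrite [- _ - _]addrC.
Qed.

Lemma coboundary_gcd f m n : (0 < n)%N ->
  coboundary (fun g h => f g h *+ m) -> coboundary (fun g h => f g h *+ n) ->
  coboundary (fun g h => f g h *+ gcdn n m).
Proof.
move=> n0 mf nf; have [u v uvE _] := egcdnP m n0.
have [t tE] := coboundaryB (coboundaryMn u nf) (coboundaryMn v mf).
exists t => g h; rewrite -tE -!mulrnA [(n * u)%N]mulnC uvE mulrnDr.
by rewrite [(v * m)%N]mulnC addrAC subrr add0r.
Qed.

(** The multipliers are closed under gcd; as long as [n > 1], taking the gcd of
    [n] with a multiplier prime to some prime divisor of [n] yields a smaller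
    one, with no new prime divisors. *)
Lemma coboundary_coprime_multiples f n :
    (0 < n)%N -> coboundary (fun g h => f g h *+ n) ->
    (forall p, prime p -> (p %| n)%N ->
      exists2 m, coprime p m & coboundary (fun g h => f g h *+ m)) ->
  coboundary f.
Proof.
have [k] := ubnP n; elim: k n => // k IHk n /ltnSE nk n0 nf primes_f.
have [n1|n_gt1] := leqP n 1.
  have nE : n = 1%N by apply/eqP; rewrite eqn_leq n1 n0.
  by rewrite nE in nf; exact: nf.
have [m pm mf] := primes_f _ (pdiv_prime n_gt1) (pdiv_dvd n).
apply: (IHk (gcdn n m)) => [|||p' p'P p'd].
- apply: leq_trans nk; rewrite ltn_neqAle dvdn_leq ?dvdn_gcdl // andbT.
  apply/eqP => gcdE; move: pm; rewrite prime_coprime ?pdiv_prime //.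
  by move=> /negP[]; rewrite (dvdn_trans (pdiv_dvd n)) // -gcdE dvdn_gcdr.
- by rewrite gcdn_gt0 n0.
- exact: coboundary_gcd.
- exact: primes_f p'P (dvdn_trans p'd (dvdn_gcdl n m)).
Qed.

End Multiples.

(** * Transfer from a subgroup *)

Section Transfer.
Variables (Q : finGroupType) (A : zmodType) (f : cocycle2 Q A) (S : {group Q}).

(** A cocycle trivial on [S] is cohomologous to one that vanishes on [Q * S], not
    only on [S * S].  In terms of extensions, [t] lifts [S] to a subgroup; the
    section of [Q] is chosen arbitrarily on representatives [r] of the left
    cosets of [S] and extended to [r * s] by multiplying the two lifts. *)
Lemma coboundary_subgroup_extend :
    coboundary (fun s s' : subg_of S => f (sgval s) (sgval s')) ->
  exists c : Q -> A,
    forall g s, s \in S -> f g s + c (g * s)%g = c g + c s.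
Proof.
case=> t tE.
pose r g := repr (g *: S)%g.
have rS g : ((r g)^-1 * g)%g \in S.
  by rewrite -mem_lcoset lcoset_sym (mem_repr g) ?lcoset_refl.
pose c g := t (subg S ((r g)^-1 * g)%g) - f (r g) ((r g)^-1 * g)%g.
exists c => g s sS.
have rgs : r (g * s)%g = r g by rewrite /r lcosetM lcoset_id.
(* The representative of [S] itself is 1, so that [c] agrees with [t] on [S]. *)
have rs : r s = 1%g by rewrite /r lcoset_id ?repr_group.
rewrite /c rgs rs invg1 mul1g cocycle21g subr0.
have gE : (r g * ((r g)^-1 * g))%g = g by rewrite mulgA mulgV mul1g.
rewrite [(_ * (g * s))%g]mulgA.
(* [g = x * y], with [x] a coset representative and [y] in [S]. *)
move: (rS g) gE; set x := r g; set y := (x^-1 * g)%g => yS gE.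
have cocyc := cocycle2A f x y s; rewrite gE in cocyc.
have := tE (subg S y) (subg S s); rewrite !subgK // => ysE.
rewrite subgM //.
apply: (addIr (f x y)); rewrite addrAC [f g s + _]addrC cocyc ysE.
by rewrite addrACA subrr addr0 subrK [RHS]addrAC subrK.
Qed.

(** This is the corestriction of the restriction, computed on cochains: once
    [f' = f - dc] vanishes on [Q * S], the cocycle identity makes [f' g k] depend
    only on the coset [k *: S], and summing that identity over the cosets
    exhibits the multiple of [f'] by the index as the coboundary of [F]. *)
Lemma coboundary_index :
    coboundary (fun s s' : subg_of S => f (sgval s) (sgval s')) ->
  coboundary (fun g h => f g h *+ #|[set: Q] : S|%g).
Proof.
case/coboundary_subgroup_extend=> c cE.
pose f' g h := f g h + (c (g * h)%g - (c g + c h)).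
have f'S g s : s \in S -> f' g s = 0.
  by move=> sS; rewrite /f' addrA cE ?subrr.
have f'sumE h g k : f' h g + f' (h * g)%g k
    = f h g + f (h * g)%g k + (c (h * g * k)%g - (c h + c g + c k)).
  rewrite /f' addrACA; congr (_ + _); rewrite addrCA; congr (_ + _).
  by rewrite addrAC opprD addrA subrr sub0r -opprD addrC.
have f'A h g k : f' h g + f' (h * g)%g k = f' g k + f' h (g * k)%g.
  rewrite f'sumE cocycle2A /f' [RHS]addrACA; congr (_ + _).
  rewrite [RHS]addrCA mulgA; congr (_ + _).
  rewrite [RHS]addrAC [c h + c (g * k)%g]addrC.
  by rewrite [- (c (g * k)%g + _)]opprD !addrA subrr sub0r -opprD addrA.
have f'Sr h g s : s \in S -> f' h (g * s)%g = f' h g.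
  by move=> sS; have := f'A h g s; rewrite !(f'S _ s sS) addr0 add0r.
have f'_repr h g (C : {set Q}) : C \in lcosets S [set: Q] ->
    f' h (g * repr C)%g = f' h (repr (g *: C)%g).
  case/lcosetsP=> x _ ->; rewrite -lcosetM.
  have /lcosetP[s sS ->] : repr (x *: S)%g \in (x *: S)%g.
    by rewrite (mem_repr x) ?lcoset_refl.
  have /lcosetP[s' s'S ->] : repr (g * x *: S)%g \in (g * x *: S)%g.
    by rewrite (mem_repr (g * x)%g) ?lcoset_refl.
  by rewrite mulgA (f'Sr _ _ s sS) (f'Sr _ _ s' s'S).
pose F g := \sum_(C in lcosets S [set: Q]) f' g (repr C).
have FE h g : f' h g *+ #|[set: Q] : S|%g = F h + F g - F (h * g)%g.
  apply/eqP; rewrite eq_sym subr_eq eq_sym; apply/eqP.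
  rewrite -card_lcosets -sumr_const -big_split /=.
  under eq_bigr => C _ do rewrite f'A.
  rewrite big_split /= addrC; congr (_ + _).
  (* The remaining sum is [F h] after left translation of the cosets by [g]. *)
  rewrite [RHS](reindex_inj (@lcoset_inj _ g)) /=.
  apply: eq_big => [C | C /f'_repr//].
  apply/lcosetsP/lcosetsP => -[x _ xE]; last first.
    by exists (g^-1 * x)%g; rewrite ?inE // lcosetM -xE lcosetK.
  by exists (g * x)%g; rewrite ?inE // lcosetM -xE.
exists (fun g => F g + c g *+ #|[set: Q] : S|%g) => g h.
have -> : f g h = f' g h + (c g + c h - c (g * h)%g).
  by rewrite /f' -[c g + c h - _]opprB addrK.
rewrite mulrnDl FE mulrnBl mulrnDl [LHS]addrACA.
by rewrite -opprD [X in X - _ = _]addrACA.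
Qed.

End Transfer.

(** * The prime-to-[p] part of a torsion element *)

Section PrimaryPart.
Variables (A : zmodType) (torA : torsion_group A) (p : nat).
Hypothesis p_prime : prime p.

Lemma pprojB (x y : A) : pproj p (x - y) = pproj p x - pproj p y.
Proof. by apply: (addIr (pproj p y)); rewrite -(pprojD torA) !subrK. Qed.

(** The difference between [x] and its [p]-th coordinate is a finite sum of
    elements whose orders are powers of primes other than [p]. *)
Lemma pproj_coprime_multiple (x : A) :
  exists2 m, coprime p m & x *+ m = val (pproj p x) *+ m.
Proof.
have [c xc] := pdecomposition_exists torA x.
rewrite (pproj_decomposition p xc).
(* The sum is widened so that its range contains [p]. *)
have [c0 [N cN xE]] := xc.
have {}xE := pdecomposition_widen cN (leq_maxl N p.+1) xE.
pose i := Ordinal (leq_maxr N p.+1).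
suff [m pm sum0] : exists2 m, coprime p m &
    (\sum_(q < maxn N p.+1 | q != i) val (c q)) *+ m = 0.
  by exists m => //; rewrite {1}xE (bigD1 i) //= mulrnDl sum0 addr0.
elim/big_rec: _ => [|q y qi [m pm ym]]; first by exists 1%N; rewrite ?coprimen1.
have [q_prime|/c0->] := boolP (prime q); last by exists m; rewrite ?add0r.
have /asboolP[n cn] := valP (c q).
exists (q ^ n * m)%N; last first.
  by rewrite mulrnDl mulrnA cn mul0rn mulnC mulrnA ym mul0rn addr0.
rewrite coprimeMr pm andbT coprimeXr // prime_coprime // dvdn_prime2 //.
by apply: contra qi => /eqP pq; apply/eqP/val_inj.
Qed.

Lemma pproj_common_multiple (I : finType) (x : I -> A) :
  exists2 m, coprime p m & forall i, x i *+ m = val (pproj p (x i)) *+ m.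
Proof.
have /choice[m mP] : forall i, exists m,
    coprime p m /\ x i *+ m = val (pproj p (x i)) *+ m.
  by move=> i; have [m pm xm] := pproj_coprime_multiple (x i); exists m.
exists (\prod_i m i)%N => [|i].
  elim/big_ind: _ => [|a b pa pb|i _]; first exact: coprimen1.
    by rewrite coprimeMr pa.
  by case: (mP i).
by rewrite (bigD1 i) //= !mulrnA (mP i).2.
Qed.

End PrimaryPart.

(** * Reduction to Sylow subgroups *)

Section Difference.
Variables (Q : groupType) (A : zmodType) (e e' : cocycle2 Q A) (n : nat).

Let f g h := (e g h - e' g h) *+ n.

Fact diff_multiple_g1 g : f g 1%g = 0.
Proof. by rewrite /f !cocycle2g1 subrr mul0rn. Qed.

Fact diff_multiple_1g g : f 1%g g = 0.
Proof. by rewrite /f !cocycle21g subrr mul0rn. Qed.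

Fact diff_multiple_A h g k : f h g + f (h * g)%g k = f g k + f h (g * k)%g.
Proof. by rewrite /f -!mulrnDl addrACA -opprD !cocycle2A opprD addrACA. Qed.

(** Transfer needs an actual cocycle, not just a cochain, with values
    [n * (e - e')]. *)
Definition diff_multiple : cocycle2 Q A :=
  Cocycle2 diff_multiple_g1 diff_multiple_1g diff_multiple_A.

End Difference.

Theorem theorem3p6 (G1 : zmodType) (G2 : finGroupType)
    (torG1 : torsion_group G1) (e1 e2 : cocycle2 G2 G1)
    (S : nat -> {group G2})
    (sylS : forall p, p \in \pi(#|[set: G2]|) -> (p.-Sylow([set: G2]) (S p))%g) :
  HQ_isomorphic (cocycle_im e1) e1 e2 <->
  forall p, p \in \pi(#|[set: G2]|) ->
    HQ_isomorphic (cocycle_im (induced_cocycle torG1 e1 p (S p)))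
      (induced_cocycle torG1 e1 p (S p)) (induced_cocycle torG1 e2 p (S p)).
Proof.
split=> [/HQ_isomorphic_coboundary[t tE] p _ | local_iso].
  apply/HQ_isomorphic_coboundary; exists (fun s => pproj p (t (sgval s))) => s s'.
  by rewrite /= -!(pprojB torG1) tE (pprojB torG1) (pprojD torG1).
apply/HQ_isomorphic_coboundary.
apply: (@coboundary_coprime_multiples _ _ _ #|[set: G2]|) => [||p p_prime p_dvd].
- exact: cardG_gt0.
(* The order of [G2] is the index of the trivial subgroup. *)
- rewrite -(indexg1 [set: G2]).
  apply: (coboundary_index (f := diff_multiple e1 e2 1)).
  exists (fun=> 0) => s s'.
  have s1 (u : subg_of [1 G2]%G) : sgval u = 1%g by apply/set1P/subgP.
  by rewrite !s1 cocycle2g1 addr0 subrr.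
have p_pi : p \in \pi(#|[set: G2]|) by rewrite mem_primes p_prime cardG_gt0.
have /HQ_isomorphic_coboundary[t tE] := local_iso p p_pi.
have [m pm mE] := pproj_common_multiple torG1 p_prime
  (fun gh : G2 * G2 => e1 gh.1 gh.2 - e2 gh.1 gh.2).
exists (m * #|[set: G2] : S p|%g)%N.
  rewrite coprimeMr pm prime_coprime // -p'natE //.
  by have /and3P[_ _] := sylS p p_pi.
have [u uE] : coboundary (fun g h =>
    diff_multiple e1 e2 m g h *+ #|[set: G2] : S p|%g).
  apply: coboundary_index; exists (fun s => val (t s) *+ m) => s s'.
  rewrite [LHS](mE (sgval s, sgval s')).
  rewrite [pproj p _](_ : _ = t s + t s' - t (s * s')%g); last first.
    by rewrite (pprojB torG1); exact: tE.
  by rewrite raddfB raddfD mulrnBl mulrnDl.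
by exists u => g h; rewrite mulrnA -uE.
Qed.
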